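(* For each $n$, let $\sigma\in\mathcal{S}_n$, let $\delta=\delta_n\ge 0$, let $l=l(n)\in\{1,\dots,n-1\}$ with $l(n)\to\infty$ as $n\to\infty$, and let $M=M_n$ be a (possibly randomized) stopping algorithm such that $\Pr[CM(\sigma,\tau)=\sigma_i]>0$ for all $i\in\{1,\dots,n\}$. Assume moreover that $\Pr[CM(\sigma,\tau)=\sigma_1]-\delta_n$ tends to a positive constant as $n\to\infty$. If $M_n$ is $(\varepsilon,\delta_n)$-differentially private with respect to $d_{l(n)}$ (where $\varepsilon=\varepsilon_n$ may depend on $n$), then $\Pr[CM(\sigma,\tau)=\sigma_1]\to 0$ or $\varepsilon_n\to\infty$ as $n\to\infty$.
   Context: Let $\mathcal{C}=\{C_1,\dots,C_n\}$ be a set of $n$ candidates. A qualification ordering is a permutation $\sigma=(\sigma_1,\dots,\sigma_n)$ of $\mathcal{C}$, meaning $\sigma_1>\sigma_2>\dots>\sigma_n$ ($\sigma_k$ is the $k$-th best candidate); $\mathcal{S}_n$ denotes the set of qualification orderings. A time ordering is a permutation $\tau=(\tau_1,\dots,\tau_n)$ of $\mathcal{C}$ giving the order in which candidates arrive; $\mathcal{T}_n$ is the set of time orderings, and $\tau$ is always chosen uniformly at random from $\mathcal{T}_n$. A stopping time is a map $M:\mathcal{S}_n\times\mathcal{T}_n\to\{1,\dots,n\}$ such that whether $M(\sigma,\tau)=t$ depends only on the relative order (under $\sigma$) of $\tau_1,\dots,\tau_t$; randomized stopping algorithms may additionally use independent internal randomness, and probabilities are over $\tau$ and this randomness. Write $CM(\sigma,\tau):=\tau_{M(\sigma,\tau)}$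 for the selected candidate. For $l\in\{1,\dots,n-1\}$, the $l$-distance $d_l(\sigma,\rho)$ is the minimum $k$ such that $\sigma=\pi_1\circ\cdots\circ\pi_k\circ\rho$ where each $\pi_i$ is a transposition of two elements that are at most $l$ positions apart in the permutation $\pi_{i+1}\circ\cdots\circ\pi_k\circ\rho$. A randomized stopping algorithm $M$ is $(\varepsilon,\delta)$-differentially private w.r.t. $d_l$ if for all $S\subseteq\mathcal{C}$ and all $\sigma,\rho\in\mathcal{S}_n$ with $d_l(\sigma,\rho)\le 1$: $\Pr[CM(\sigma,\tau)\in S]\le e^{\varepsilon}\Pr[CM(\rho,\tau)\in S]+\delta$. *)

(* Defs.v *)
From HB Require Import structures.
From mathcomp Require Import all_boot all_order all_algebra all_fingroup.
From mathcomp Require Import all_classical all_reals all_analysis.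

Set Implicit Arguments.
Unset Strict Implicit.
Unset Printing Implicit Defensive.

Import Order.TTheory GRing.Theory Num.Theory.
Import numFieldNormedType.Exports.

Local Open Scope classical_set_scope.
Local Open Scope ring_scope.

(* The n candidates are the elements of 'I_n.  Qualification orderings and time
   orderings are permutations s : {perm 'I_n} read as the sequence
   (s 0, ..., s n.-1), so indices, ranks and times are 0-based: s 0 is the best
   (resp. the first arriving) candidate, and s^-1 c is the position of c.
   Composition in MathComp is left to right: (s * t) k = t (s k), so the
   usual pi o rho, in which pi acts on candidates, is (rho * pi)%g. *)

Section LDistance.
Variables (n l : nat).
Hypothesis l_gt0 : (0 < l)%N.
Implicit Types s r t : {perm 'I_n}.

(* s is obtained from r by k successive transpositions (the last one applied
   being the outermost), each exchanging two candidates that are at most l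
   positions apart in the ordering to which it is applied. *)
Fixpoint l_swaps (k : nat) s r : bool :=
  if k is k'.+1 then
    [exists t : {perm 'I_n}, exists a : 'I_n, exists b : 'I_n,
      [&& l_swaps k' t r, a != b,
          (`|(t^-1)%g a - (t^-1)%g b| <= l)%N & s == (t * tperm a b)%g]]
  else s == r.

Lemma l_swaps_trans s t r : (exists k, l_swaps k s t) ->
  (exists k, l_swaps k t r) -> exists k, l_swaps k s r.
Proof.
case=> k1 + [k2 tr]; elim: k1 s => [|k1 IH] s /=.
  by move/eqP=> ->; exists k2.
case/existsP=> u /existsP[a] /existsP[b] /and4P[/IH[k ur] ab lab sE].
exists k.+1; apply/existsP; exists u; apply/existsP; exists a.
by apply/existsP; exists b; apply/and4P.
Qed.

Lemma l_swaps_tperm (i j : 'I_n) r :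
  (i < j)%N -> exists k, l_swaps k (tperm i j * r)%g r.
Proof.
have [m] := ubnP (j - i)%N; elim: m i j r => // m IH i j r.
rewrite ltnS => le_m lt_ij; have [adj|nadj] := eqVneq (j : nat) i.+1.
  exists 1%N; apply/existsP; exists r; apply/existsP; exists (r i).
  apply/existsP; exists (r j); apply/and4P; split=> /=; first exact: eqxx.
  - by rewrite (inj_eq perm_inj) neq_ltn lt_ij.
  - by rewrite !permK distnEr ?adj // subSnn.
  - by rewrite -tpermJ conjgC.
have lt_i1j : (i.+1 < j)%N by rewrite ltn_neqAle eq_sym nadj.
pose h := Ordinal (ltn_trans lt_i1j (ltn_ord j)).
have ik : (i < h)%N by [].
have ltm : (1 < m)%N.
  by apply: (leq_trans _ le_m); rewrite ltn_subRL addn1.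
have kj : (j - h < m)%N.
  by apply: (leq_trans _ le_m); rewrite ltn_sub2l.
have swap_ih q : exists k, l_swaps k (tperm i h * q)%g q.
  by apply: IH; rewrite //= subSnn.
have -> : (tperm i j * r = tperm i h * (tperm h j * (tperm i h * r)))%g.
  have jE : tperm i h j = j by rewrite tpermD ?neq_ltn ?lt_ij //= lt_i1j.
  have <- : (tperm h j ^ tperm i h = tperm i j)%g by rewrite tpermJ tpermR jE.
  by rewrite conjgE tpermV !mulgA.
apply: l_swaps_trans (swap_ih _) _.
by apply: l_swaps_trans (swap_ih r); apply: IH.
Qed.

Lemma l_swaps_ex s r : exists k, l_swaps k s r.
Proof.
have [ts ->] : exists ts : seq ('I_n * 'I_n),
    s = ((\prod_(t <- ts) tperm t.1 t.2) * r)%g.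
  have [ts E _] := prod_tpermP (s * r^-1)%g; exists ts.
  by rewrite -E mulgKV.
elim: ts => [|[i j] ts IH]; first by exists 0%N; rewrite big_nil mul1g /=.
rewrite big_cons -mulgA /=; case: (ltngtP i j) => [ij|ji|/val_inj ->].
- exact: l_swaps_trans (l_swaps_tperm _ ij) IH.
- by rewrite tpermC; exact: l_swaps_trans (l_swaps_tperm _ ji) IH.
- by rewrite tperm1 mul1g.
Qed.

Definition l_distance s r : nat := ex_minn (l_swaps_ex s r).

End LDistance.

(* Only ranks are compared, not identities of candidates, and s and s' may
   differ; indices are 0-based, so this concerns the first t+1 arrivals. *)
Definition same_relative_order n (t : 'I_n) (s a s' a' : {perm 'I_n}) : Prop :=
  forall i j : 'I_n, (i <= t)%N -> (j <= t)%N ->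
    ((s^-1)%g (a i) < (s^-1)%g (a j))%N =
    ((s'^-1)%g (a' i) < (s'^-1)%g (a' j))%N.

Definition stopping_time n (M : {perm 'I_n} -> {perm 'I_n} -> 'I_n) : Prop :=
  forall (t : 'I_n) (s a s' a' : {perm 'I_n}),
    same_relative_order t s a s' a' -> (M s a = t <-> M s' a' = t).

(* Internal randomness is a point w of an arbitrary probability space, drawn
   independently of the arrival order; each realization is a stopping time. *)
Record stopping_algorithm (R : realType) (n : nat) := StoppingAlgorithm {
  seed_display : measure_display;
  seed : measurableType seed_display;
  seed_law : probability seed R;
  stop : seed -> {perm 'I_n} -> {perm 'I_n} -> 'I_n;
  stop_measurable : forall (s a : {perm 'I_n}) (t : 'I_n),
    measurable [set w | stop w s a = t];
  stop_stopping_time : forall w, stopping_time (stop w)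
}.

Section Privacy.
Variables (R : realType) (n : nat) (M : stopping_algorithm R n).

Definition selected (w : seed M) (s a : {perm 'I_n}) : 'I_n :=
  a (stop w s a).

(* Probability that the selected candidate lies in S, under the product of the
   uniform law on time orderings a and the law of the internal randomness. *)
Definition pr_selected (s : {perm 'I_n}) (S : {set 'I_n}) : R :=
  (#|{perm 'I_n}|%:R)^-1 *
  \sum_(a : {perm 'I_n}) fine (seed_law M [set w | selected w s a \in S]).

Definition diff_private (l : nat) (l_gt0 : (0 < l)%N) (eps delta : R) : Prop :=
  forall (S : {set 'I_n}) (s r : {perm 'I_n}),
    (l_distance l_gt0 s r <= 1)%N ->
    pr_selected s S <= expR eps * pr_selected r S + delta.

End Privacy.

(* Main.v *)
(* By relabelling time orderings, the probability that the i-th best candidate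
   is selected is the same for all qualification orderings; call it p_i.
   Swapping the best candidate with the one k <= l places below is a single
   step for d_l, so privacy gives p_0 <= e^eps p_k + delta.  Summing over k and
   using that the p_k add up to at most 1, l (p_0 - delta) <= e^eps, which
   forces eps to diverge. *)

Require Import Defs.
From mathcomp Require Import all_boot all_order all_algebra all_fingroup.
From mathcomp Require Import all_classical all_reals all_analysis.

Import Order.TTheory GRing.Theory Num.Theory.
Import numFieldNormedType.Exports.

Local Open Scope classical_set_scope.
Local Open Scope ring_scope.

(** Right multiplication by [s^-1 * r] renames each candidate to the one holding the same rank under
    [r]. Ranks of arrivals are thus unchanged, and a stopping time sees nothing else. *)
Lemma stop_relabel (R : realType) (n : nat) (M : stopping_algorithm R n)
    (w : seed M) (s r a : {perm 'I_n}) :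
  stop w r (a * (s^-1 * r))%g = stop w s a.
Proof.
have E : same_relative_order (stop w s a) s a r (a * (s^-1 * r))%g.
  by move=> i j _ _; rewrite !permM !permK.
by have [/(_ erefl)] := stop_stopping_time w E.
Qed.

Lemma pr_selected_rank (R : realType) (n : nat) (M : stopping_algorithm R n)
    (s r : {perm 'I_n}) (i : 'I_n) :
  pr_selected M r [set r i]%SET = pr_selected M s [set s i]%SET.
Proof.
rewrite /pr_selected; congr (_ * _).
(* The renaming permutes the time orderings, so it preserves their uniform law. *)
rewrite (reindex_inj (mulIg (s^-1 * r)%g)) /=; apply: eq_bigr => a _.
congr (fine (seed_law M _)); apply/seteqP; split=> w /=;
  rewrite !inE /selected stop_relabel !permM.
- by move/eqP/perm_inj => <-; rewrite permKV.
- by move/eqP => ->; rewrite permK.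
Qed.

Lemma measurable_selected (R : realType) (n : nat)
    (M : stopping_algorithm R n) (s a : {perm 'I_n}) (c : 'I_n) :
  measurable [set w : seed M | selected w s a \in [set c]%SET].
Proof.
have := stop_measurable M s a ((a^-1)%g c).
congr measurable; apply/seteqP; split=> w /=; rewrite inE /selected.
- by move=> ->; rewrite permKV.
- by move/eqP <-; rewrite permK.
Qed.

(** For a fixed time ordering, the events indexed by the selected candidate partition the seed
    space. *)
Lemma sum_law_selected (R : realType) (n : nat) (M : stopping_algorithm R n)
    (s a : {perm 'I_n}) :
  \sum_(c : 'I_n) fine (seed_law M [set w | selected w s a \in [set c]%SET])
  = 1.
Proof.
rewrite sum_fine; last by move=> c _; exact/fin_num_measure/measurable_selected.
rewrite -(measure_bigsetU_ord (seed_law M) predT) //.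
- rewrite (_ : \big[_/_]_(c < _) _ = setT).
    by rewrite [X in fine X](probability_setT (seed_law M)).
  apply/seteqP; split=> // w _; rewrite (bigD1 (selected w s a)) //=; left.
  by rewrite /= inE.
- by move=> c; exact: measurable_selected.
- move=> c d _ _ [w /= []]; rewrite !inE => /eqP <- /eqP //.
Qed.

Lemma sum_pr_selected (R : realType) (n : nat) (M : stopping_algorithm R n)
    (s : {perm 'I_n}) :
  \sum_(c : 'I_n) pr_selected M s [set c]%SET = 1.
Proof.
rewrite -mulr_sumr exchange_big /=.
under eq_bigr do rewrite sum_law_selected.
rewrite sumr_const mulVf // pnatr_eq0 -lt0n; apply/card_gt0P.
by exists 1%g.
Qed.

Lemma pr_selected_ge0 (R : realType) (n : nat) (M : stopping_algorithm R n)
    (s : {perm 'I_n}) (S : {set 'I_n}) : 0 <= pr_selected M s S.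
Proof.
by rewrite mulr_ge0 ?invr_ge0 //; apply: sumr_ge0 => a _; exact: fine_ge0.
Qed.

Lemma l_distance_tperm (n l : nat) (l_gt0 : (0 < l)%N) (s : {perm 'I_n})
    (i j : 'I_n) : i != j -> (`|i - j| <= l)%N ->
  (l_distance l_gt0 s (tperm i j * s)%g <= 1)%N.
Proof.
move=> ij ijl; rewrite /l_distance; case: ex_minnP => m _; apply.
set r := (tperm i j * s)%g.
apply/existsP; exists r; apply/existsP; exists (r i).
apply/existsP; exists (r j); apply/and4P; split; first exact: eqxx.
- by rewrite (inj_eq perm_inj).
- by rewrite !permK.
(* Conjugation by [r] turns the swap of two positions into the swap of the candidates there, and a
   second swap undoes the first. *)
- by rewrite -tpermJ -conjgC /r mulgA tperm2 mul1g.
Qed.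

Lemma diff_private_expR_ge (R : realType) (n l : nat)
    (M : stopping_algorithm R n.+1) (l_gt0 : (0 < l)%N) (eps delta : R)
    (s : {perm 'I_n.+1}) : (l < n.+1)%N -> diff_private M l_gt0 eps delta ->
  l%:R * (pr_selected M s [set s ord0]%SET - delta) <= expR eps.
Proof.
move=> ln dp.
have step (k : 'I_n.+1) : (0 < k <= l)%N ->
    pr_selected M s [set s ord0]%SET - delta <=
      expR eps * pr_selected M s [set s k]%SET.
  case/andP=> k0 kl; rewrite lerBlDr.
  (* In the swapped ordering the candidate [s ord0] holds rank [k], so rank invariance identifies
     its probability there. *)
  rewrite -(@pr_selected_rank _ _ M s (tperm ord0 k * s)%g k) permM tpermR.
  apply/dp/l_distance_tperm; first by rewrite neq_ltn k0.
  by rewrite dist0n.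
have -> : l%:R * (pr_selected M s [set s ord0]%SET - delta) =
    \sum_(k < n.+1 | (0 < k <= l)%N) (pr_selected M s [set s ord0]%SET - delta).
  (* Dropping index 0 leaves 1 to [l], all of them valid ranks because [l < n.+1]. *)
  rewrite big_mkcond big_ord_recl /= add0r -big_mkcond.
  by rewrite -(big_ord_widen _ (fun=> _)) // sumr_const card_ord mulr_natl.
apply: le_trans; first by apply: ler_sum => k; exact: step.
rewrite -mulr_sumr ler_piMr ?expR_ge0 //.
(* The total mass 1, reindexed by rank, contains the partial sum; the remaining terms are
   nonnegative. *)
rewrite -(@sum_pr_selected _ _ M s) [leRHS](reindex_inj (@perm_inj _ s)) /=.
rewrite [leRHS](bigID (fun k : 'I_n.+1 => 0 < k <= l)%N) /= lerDl.
by apply: sumr_ge0 => k _; exact: pr_selected_ge0.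
Qed.

Theorem theorem1 (R : realType)
    (sigma : forall n : nat, {perm 'I_n.+2})
    (delta eps : nat -> R) (l : nat -> nat)
    (M : forall n : nat, stopping_algorithm R n.+2)
    (delta_ge0 : forall n : nat, 0 <= delta n)
    (l_gt0 : forall n : nat, (0 < l n)%N)
    (l_ltn : forall n : nat, (l n < n.+2)%N)
    (l_infty : l n @[n --> \oo] --> \oo)
    (selected_gt0 : forall (n : nat) (i : 'I_n.+2),
      0 < pr_selected (M n) (sigma n) [set sigma n i]%SET)
    (gap : exists2 c : R, 0 < c &
      pr_selected (M n) (sigma n) [set sigma n ord0]%SET - delta n
        @[n --> \oo] --> c)
    (private : forall n : nat,
      diff_private (M n) (l_gt0 n) (eps n) (delta n)) :
  (pr_selected (M n) (sigma n) [set sigma n ord0]%SET @[n --> \oo] --> (0 : R))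
  \/ (eps n @[n --> \oo] --> +oo).
Proof.
(* The first alternative would contradict [gap], since [delta n >= 0]. *)
right; case: gap => c c_gt0 cvg_c; apply/cvgryPge => A.
(* The gap eventually exceeds [c / 2]; this threshold on [l n] then makes [l n] times the gap at
   least [expR A]. *)
have [N _ lN] : \forall n \near \oo,
    ((Num.truncn (expR A / (c / 2))).+1 <= l n)%N.
  by move/cvgnyPge: l_infty; apply.
have half : c / 2 < c by rewrite ltr_pdivrMr // ltr_pMr // ltr1n.
near=> n.
rewrite -ler_expR; apply: le_trans; last first.
  exact: (@diff_private_expR_ge _ _ _ _ _ _ _ (sigma n) (l_ltn n) (private n)).
have gap_n : c / 2 <=
    pr_selected (M n) (sigma n) [set sigma n ord0]%SET - delta n.
  by apply: ltW; near: n; exact: cvgr_gt cvg_c _ half.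
have l_n : expR A / (c / 2) <= (l n)%:R.
  apply/ltW/(lt_le_trans (truncnS_gt _)); rewrite ler_nat; apply: lN => /=.
  by near: n; exact: nbhs_infty_ge.
apply: le_trans (ler_wpM2l _ gap_n) => //.
by rewrite -ler_pdivrMr // divr_gt0.
Unshelve. all: by end_near.
Qed.
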